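(* For each $l=1,2,\dots,L-1$ the approximate solutions $\tilde y_l^*$ produced by the discrete multi-grade deep learning model satisfy $$\|y-\tilde y_{l+1}^*\|_N\le \mathrm{cond}(\mathbf{M}_\kappa)\,\|y-\tilde y_l^*\|_N+2\,\|\mathbf{M}_\kappa^{-1}\|_2\,\|(\mathcal{K}_{p_\kappa}-\mathcal{K})y\|_N ,$$ where $\mathrm{cond}(\mathbf{M}_\kappa)=\|\mathbf{M}_\kappa\|_2\|\mathbf{M}_\kappa^{-1}\|_2$ is the condition number of the matrix $\mathbf{M}_\kappa$.
   Context: Let $I:=[-1,1]$, and let $C(I)$ be the space of continuous complex-valued functions on $I$. Let $\kappa\ge 1$, let $K$ be a continuous complex-valued function on $I^2$, and $f\in C(I)$. Define $(\mathcal{K}h)(s):=\int_I K(s,t)e^{i\kappa|s-t|}h(t)\,dt$ for $h\in C(I)$, $s\in I$; $\mathcal{I}$ is the identity on $C(I)$. The function $y\in C(I)$ is the solution of $(\mathcal{I}-\mathcal{K})y=f$. Let $x_1,\dots,x_N\in I$ be distinct (collocation) points and $\|g\|_N:=\sqrt{\frac1N\sum_{j=1}^N|g(x_j)|^2}$ for $g\in C(I)$ (a semi-norm). Let $\mathcal{K}_{p_\kappa}:C(I)\to C(I)$ be a linear operator approximating $\mathcal{K}$ obtained from a numerical integration scheme with quadrature nodes $s_0,\dots,s_{p_\kappa}\in I$ (so $\mathcal{K}_{p_\kappa}h$ depends on $h$ only through the values $h(s_j)$). Assume that the quadrature nodes coincide with the collocation points ($p_\kappa=N-1$), and that $\mathbf{M}_\kappa\in\mathbb{C}^{N\times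 N}$ is an invertible matrix such that $[((\mathcal{I}-\mathcal{K}_{p_\kappa})h)(x_j)]_{j=1}^N=\mathbf{M}_\kappa[h(x_j)]_{j=1}^N$ for all $h\in C(I)$. For matrices, $\|\cdot\|_2$ is the spectral norm. For a function $u=[u_1,u_2]^T$ with $u_1,u_2$ real-valued on $I$, $\mathcal{T}u:=u_1+iu_2$. Let $\sigma:\mathbb{R}\to\mathbb{R}$ be a continuous activation function, applied componentwise. For weight matrices $\mathbf{W}_j$ and bias vectors $\mathbf{b}_j$ of compatible sizes and an input vector $x$, let $\mathcal{F}_k(\{\mathbf{W}_j,\mathbf{b}_j\}_{j=1}^k;x)$ be the result of applying to $x$ successively the maps $v\mapsto\sigma(\mathbf{W}_jv+\mathbf{b}_j)$, $j=1,\dots,k$ (the identity if $k=0$), and let $\mathcal{N}_n(\{\mathbf{W}_j,\mathbf{b}_j\}_{j=1}^n;x):=\mathbf{W}_n\mathcal{F}_{n-1}(\{\mathbf{W}_j,\mathbf{b}_j\}_{j=1}^{n-1};x)+\mathbf{b}_n$. Discrete multi-grade deep learning model: let $L$ and $n_1,\dots,n_L$ be positive integers, and let $m_{l,j}$ ($1\le l\le L$, $0\le j\le n_l$) be positive integers with $m_{1,0}=1$, $m_{l,n_l}=2$, $m_{l+1,0}=m_{l,n_l-1}$. Put $\tilde{\mathbf{g}}_0(s):=s$ and $\tilde e_0^*:=f$. Recursively for $l=1,\dots,L$: for $\theta=\{\mathbf{W}_j,\mathbf{b}_j\}_{j=1}^{n_l}$ with $\mathbf{W}_j\in\mathbb{R}^{m_{l,j}\times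 m_{l,j-1}}$, $\mathbf{b}_j\in\mathbb{R}^{m_{l,j}}$, set $$\tilde e_l(\theta;s):=\tilde e_{l-1}^*(s)-\big[(\mathcal{I}-\mathcal{K}_{p_\kappa})\mathcal{T}\mathcal{N}_{n_l}(\theta;\tilde{\mathbf{g}}_{l-1}(\cdot))\big](s),\quad s\in I;$$ let $\{\tilde{\mathbf{W}}_{l,j}^*,\tilde{\mathbf{b}}_{l,j}^*\}_{j=1}^{n_l}$ be a minimizer of $\|\tilde e_l(\theta;\cdot)\|_N^2$ over all such $\theta$ (existence of minimizers is assumed throughout); set $\tilde{\mathbf{g}}_l(s):=\mathcal{F}_{n_l-1}(\{\tilde{\mathbf{W}}_{l,j}^*,\tilde{\mathbf{b}}_{l,j}^*\}_{j=1}^{n_l-1};\tilde{\mathbf{g}}_{l-1}(s))$, $\tilde{\mathbf{f}}_l(s):=\tilde{\mathbf{W}}_{l,n_l}^*\tilde{\mathbf{g}}_l(s)+\tilde{\mathbf{b}}_{l,n_l}^*$, $\tilde y_l^*:=\sum_{j=1}^l\mathcal{T}\tilde{\mathbf{f}}_j$, and $\tilde e_l^*(s):=\tilde e_l(\{\tilde{\mathbf{W}}_{l,j}^*,\tilde{\mathbf{b}}_{l,j}^*\}_{j=1}^{n_l};s)$. *)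

(* Defs.v *)
From HB Require Import structures.
From mathcomp Require Import all_boot all_order all_algebra.
From mathcomp Require Import complex.
From mathcomp Require Import all_classical all_reals all_analysis.
Set Implicit Arguments.
Unset Strict Implicit.
Unset Printing Implicit Defensive.
Import Order.TTheory GRing.Theory Num.Theory.
Import numFieldNormedType.Exports.
Local Open Scope classical_set_scope.
Local Open Scope ring_scope.
Local Open Scope complex_scope.

Section IntegralEquation.
Variable R : realType.

Definition I : set R := `[-1, 1]%classic.

(* Elements of C(I) are represented by functions on the whole line; only their
   values on I are ever constrained or used. *)
Definition CI (h : R -> R[i]) : Prop :=
  {within I, continuous (h : R -> R[i]^o)}.

Definition CI2 (K : R -> R -> R[i]) : Prop :=
  {within I `*` I, continuous (fun st : R * R => K st.1 st.2 : R[i]^o)}.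

Definition cis (a : R) : R[i] := cos a +i* sin a.

Definition cintegral (g : R -> R[i]) : R[i] :=
  (\int[lebesgue_measure]_(t in I) complex.Re (g t))%R +i*
  (\int[lebesgue_measure]_(t in I) complex.Im (g t))%R.

Definition osc_op (kappa : R) (K : R -> R -> R[i]) (h : R -> R[i]) (s : R)
  : R[i] :=
  cintegral (fun t => K s t * cis (kappa * `|s - t|) * h t).

Definition id_sub (A : (R -> R[i]) -> R -> R[i]) (h : R -> R[i]) (s : R)
  : R[i] :=
  h s - A h s.

(* A linear operator C(I) -> C(I) using only the values at the nodes s_j.
   When the nodes lie in I, the last clause also makes A h, on I, independent
   of the values of h off I. *)
Definition quadrature_operator (p : nat) (s : 'I_p.+1 -> R)
    (A : (R -> R[i]) -> R -> R[i]) : Prop :=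
  [/\ forall h, CI h -> CI (A h),
      forall (a : R[i]) h1 h2, CI h1 -> CI h2 ->
        forall t, I t ->
          A (fun r => a * h1 r + h2 r) t = a * A h1 t + A h2 t
    & forall h1 h2, CI h1 -> CI h2 -> (forall j, h1 (s j) = h2 (s j)) ->
        forall t, I t -> A h1 t = A h2 t].

Definition normN (N : nat) (x : 'I_N -> R) (g : R -> R[i]) : R :=
  Num.sqrt (N%:R^-1 * \sum_(j < N) Normc.normc (g (x j)) ^+ 2).

Definition l2norm (N : nat) (v : 'cV[R[i]]_N) : R :=
  Num.sqrt (\sum_(j < N) Normc.normc (v j 0) ^+ 2).

Definition specnorm (N : nat) (M : 'M[R[i]]_N) : R :=
  sup [set l2norm (M *m v) | v in [set v : 'cV[R[i]]_N | l2norm v <= 1]].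

Definition cond (N : nat) (M : 'M[R[i]]_N) : R :=
  specnorm M * specnorm (invmx M).

End IntegralEquation.

Section Networks.
Variable R : realType.

(* The weights and biases {W_j, b_j}, j = 1..n, of a network with layer widths
   m 0, ..., m n; weight j is W_j, of size m_j x m_(j-1).  The families are
   total in j, but F and net below read only the entries with 1 <= j <= n. *)
Record params (m : nat -> nat) := Params {
  weight : forall j : nat, 'M[R]_(m j, m j.-1);
  bias : forall j : nat, 'cV[R]_(m j)
}.

(* The identity when p = q. It is used only between dimensions which the
   constraints on the architecture make equal, but not convertible. *)
Definition recast (p q : nat) (v : 'cV[R]_p) : 'cV[R]_q := conform_mx 0 v.

Variable sigma : R -> R.

Fixpoint F (m : nat -> nat) (th : params m) (k : nat) (x : 'cV[R]_(m 0%N))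
  : 'cV[R]_(m k) :=
  match k with
  | 0%N => x
  | k'.+1 => map_mx sigma (weight th k'.+1 *m F th k' x + bias th k'.+1)
  end.

Definition net (m : nat -> nat) (th : params m) (n : nat) (x : 'cV[R]_(m 0%N))
  : 'cV[R]_(m n) :=
  weight th n *m F th n.-1 x + bias th n.

Definition T (q : nat) (u : 'cV[R]_q) : R[i] :=
  let v : 'cV[R]_2 := recast 2 u in v 0 0 +i* v 1 0.

End Networks.

(* Discrete multi-grade model.  Grades are numbered from 1; n l is the depth of
   grade l, m l j the width of its layer j, and th l the parameters retained
   for it.  A stands for the discretised operator. *)
Section MultiGrade.
Variables (R : realType) (sigma : R -> R) (A : (R -> R[i]) -> R -> R[i]).
Variables (f : R -> R[i]) (n : nat -> nat) (m : nat -> nat -> nat).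
Variable th : forall l : nat, params R (m l).

Definition gdim (l : nat) : nat :=
  if l is l'.+1 then m l'.+1 (n l'.+1).-1 else 1.

Fixpoint gtilde (l : nat) : R -> 'cV[R]_(gdim l) :=
  match l with
  | 0%N => fun s => const_mx s
  | l'.+1 => fun s =>
      F sigma (th l'.+1) (n l'.+1).-1 (recast (m l'.+1 0%N) (gtilde l' s))
  end.

Definition ftilde (l : nat) : R -> 'cV[R]_(m l (n l)) :=
  match l with
  | 0%N => fun=> 0
  | l'.+1 => fun s =>
      weight (th l'.+1) (n l'.+1) *m gtilde l'.+1 s + bias (th l'.+1) (n l'.+1)
  end.

Definition ytilde (l : nat) (s : R) : R[i] :=
  \sum_(1 <= j < l.+1) T (ftilde j s).

Definition residual (e : R -> R[i]) (l : nat) (t : params R (m l)) (s : R)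
  : R[i] :=
  e s - id_sub A
          (fun r => T (net sigma t (n l) (recast (m l 0%N) (gtilde l.-1 r)))) s.

Fixpoint estar (l : nat) : R -> R[i] :=
  if l is l'.+1 then residual (estar l') (th l'.+1) else f.

Definition etilde (l : nat) (t : params R (m l)) : R -> R[i] :=
  residual (estar l.-1) t.

End MultiGrade.

(* Main.v *)
Require Import Defs.
From HB Require Import structures.
From mathcomp Require Import all_boot all_order all_algebra.
From mathcomp Require Import complex.
From mathcomp Require Import lra.
From mathcomp Require Import all_classical all_reals all_analysis.
Set Implicit Arguments.
Unset Strict Implicit.
Unset Printing Implicit Defensive.
Import Order.TTheory GRing.Theory Num.Theory.
Import numFieldNormedType.Exports.
Local Open Scope classical_set_scope.
Local Open Scope ring_scope.
Local Open Scope complex_scope.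

(** Everything takes place in C^N.  Write [v_g] for the vector of the values
    of [g] at the collocation points ([nodal x g]); the semi-norm [normN x g]
    is a fixed multiple of the Euclidean norm of [v_g] ([normN_nodal]).  Let
    [d_l] be the vector of the error [y - ytilde l], [e_l] that of the optimal
    residual [estar l], and [q] that of [Kp y - osc_op kappa K y].

    Since the discretised operator acts at the nodes as the matrix [M], summing
    the definitions of the residuals gives [e_l = v_f - M v_(ytilde l)]
    ([nodal_estar]), and the integral equation turns [v_f] into [M v_y + q].
    Hence the identity on which the estimate rests:
    [[
      M d_l = e_l - q.
    ]]
    It is used in both directions.  At grade l+1 one inverts [M], and at grade
    l one reads off [e_l]:
    [[
      |d_(l+1)| <= |M^-1| (|e_(l+1)| + |q|),    |e_l| <= |M| |d_l| + |q|.
    ]]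
    The two are linked by [|e_(l+1)| <= |e_l|]: the network of grade l+1 whose
    parameters all vanish outputs the zero function, so it leaves the residual
    [e_l] unchanged ([nodal_etilde0]), and the minimizer does at least as well.
    Chaining the three inequalities gives the theorem; the factor 2 comes from
    the two occurrences of [|q|].

    Two ingredients are needed besides.  The spectral norm is a supremum, so
    the bound [|M v| <= |M| |v|] ([ler_l2norm_mulmx]) requires that supremum to
    be over a bounded set.  And the matrix identity holds only for continuous
    functions, so the networks have to be shown continuous ([CI_T],
    [ftilde_continuous]). *)

(** * The Euclidean norm and the spectral norm *)

Section EuclideanNorm.
Variables (R : realType) (N : nat).
Implicit Types (u v : 'cV[R[i]]_N) (M : 'M[R[i]]_N).

Lemma normc_ge0 (a : R[i]) : 0 <= Normc.normc a.
Proof. by case: a => ? ?; exact: sqrtr_ge0. Qed.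

Lemma l2norm_ge0 v : 0 <= l2norm v.
Proof. exact: sqrtr_ge0. Qed.

(** Identifies the norm with the one of the Hermitian dot product, from which
    the triangle inequality is then inherited. *)
Lemma l2norm_dotmx v : (l2norm v)%:C = sqrtC (dotmx v^T v^T).
Proof.
apply/eqP; rewrite -(@eqrXn2 _ 2) ?ler0c ?l2norm_ge0 ?sqrtC_ge0 ?dnorm_ge0 //.
rewrite sqrtCK dotmxE !mxE -rmorphXn /l2norm sqr_sqrtr; last first.
  by apply: sumr_ge0 => j _; exact: sqr_ge0.
by rewrite rmorph_sum /=; apply/eqP/eq_bigr => j _; rewrite !mxE -normCK rmorphXn.
Qed.

Lemma ler_l2normD u v : l2norm (u + v) <= l2norm u + l2norm v.
Proof.
rewrite -lecR rmorphD /= !l2norm_dotmx linearD.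
exact: (triangle_lerif (@dotmx _ N) u^T v^T).1.
Qed.

Lemma l2normZ a v : l2norm (a *: v) = Normc.normc a * l2norm v.
Proof.
transitivity (Num.sqrt (Normc.normc a ^+ 2) * l2norm v); last first.
  by rewrite sqrtr_sqr ger0_norm ?normc_ge0.
rewrite -sqrtrM ?sqr_ge0 // mulr_sumr; congr Num.sqrt.
by apply: eq_bigr => j _; rewrite mxE Normc.normcM exprMn.
Qed.

Lemma l2norm0 : l2norm (0 : 'cV[R[i]]_N) = 0.
Proof. by rewrite -(scale0r 0) l2normZ Normc.normc0 mul0r. Qed.

Lemma ler_l2normB u v : l2norm (u - v) <= l2norm u + l2norm v.
Proof.
apply: le_trans (ler_l2normD _ _) _.
by rewrite -scaleN1r l2normZ normcN Normc.normc1 mul1r.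
Qed.

Lemma ler_l2norm_sum (J : finType) (w : J -> 'cV[R[i]]_N) :
  l2norm (\sum_j w j) <= \sum_j l2norm (w j).
Proof.
elim/big_ind2: _ => [|a u b v ua vb|//]; first by rewrite l2norm0.
exact: le_trans (ler_l2normD _ _) (lerD ua vb).
Qed.

Lemma normc_le_l2norm v j : Normc.normc (v j 0) <= l2norm v.
Proof.
rewrite -[leLHS]ger0_norm ?normc_ge0 // -sqrtr_sqr ler_wsqrtr //.
by rewrite (bigD1 j) //= lerDl sumr_ge0 // => k _; exact: sqr_ge0.
Qed.

Lemma l2norm_eq0 v : l2norm v = 0 -> v = 0.
Proof.
move=> v0; apply/colP => j; rewrite mxE; apply: Normc.eq0_normc.
by apply/le_anti; rewrite normc_ge0 -v0 normc_le_l2norm.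
Qed.

(** By the triangle inequality over the columns of [M], each entry of a vector
    of the unit ball being at most 1 in modulus.  Without this bound the
    supremum defining [specnorm] could be the default value 0. *)
Lemma specnorm_bounded M :
  has_ubound [set l2norm (M *m v) | v in [set v | l2norm v <= 1]].
Proof.
exists (\sum_j l2norm (col j M)) => _ [v /= v1 <-].
have -> : M *m v = \sum_j v j 0 *: col j M.
  apply/colP => i; rewrite summxE !mxE; apply: eq_bigr => j _.
  by rewrite !mxE mulrC.
apply: le_trans (ler_l2norm_sum _) _; apply: ler_sum => j _.
rewrite l2normZ ler_piMl ?l2norm_ge0 //.
exact: le_trans (normc_le_l2norm v j) v1.
Qed.

Lemma specnorm_ge0 M : 0 <= specnorm M.
Proof.
apply: (ub_le_sup (specnorm_bounded M)); exists 0 => /=.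
  by rewrite l2norm0.
by rewrite mulmx0 l2norm0.
Qed.

Lemma ler_l2norm_mulmx M v : l2norm (M *m v) <= specnorm M * l2norm v.
Proof.
have [v0|v_neq0] := eqVneq (l2norm v) 0.
  by rewrite v0 (l2norm_eq0 v0) mulmx0 l2norm0 mulr0.
have v_gt0 : 0 < l2norm v by rewrite lt_neqAle eq_sym v_neq0 l2norm_ge0.
have normVv : Normc.normc ((l2norm v)^-1)%:C = (l2norm v)^-1.
  by rewrite /= expr0n addr0 sqrtr_sqr ger0_norm // invr_ge0 ltW.
rewrite -ler_pdivrMr // mulrC -[X in X * _]normVv -l2normZ scalemxAr.
apply: (ub_le_sup (specnorm_bounded M)); exists (((l2norm v)^-1)%:C *: v) => //=.
by rewrite l2normZ normVv mulVf.
Qed.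

End EuclideanNorm.

(** * Values at the collocation points *)

Section NodalVector.
Variables (R : realType) (N : nat) (x : 'I_N -> R).

Definition nodal (g : R -> R[i]) : 'cV[R[i]]_N := \col_j g (x j).

Lemma normN_nodal g : normN x g = Num.sqrt N%:R^-1 * l2norm (nodal g).
Proof.
rewrite -sqrtrM ?invr_ge0 ?ler0n //; congr (Num.sqrt (_ * _)).
by apply: eq_bigr => j _; rewrite mxE.
Qed.

Lemma normN_ge0 g : 0 <= normN x g.
Proof. exact: sqrtr_ge0. Qed.

Lemma eq_nodal g h : (forall j, g (x j) = h (x j)) -> nodal g = nodal h.
Proof. by move=> gh; apply/colP => j; rewrite !mxE. Qed.

Lemma nodalB g h : nodal (fun r => g r - h r) = nodal g - nodal h.
Proof. by apply/colP => j; rewrite !mxE. Qed.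

Lemma nodal0 : nodal (fun=> 0) = 0.
Proof. by apply/colP => j; rewrite !mxE. Qed.

End NodalVector.

(** * Continuity of the networks *)

Section NetworkContinuity.
Variable R : realType.

Lemma complex_continuous (u v : R -> R) : continuous u -> continuous v ->
  continuous ((fun r => u r +i* v r) : R -> R[i]^o).
Proof.
move=> cu cv.
have cC (w : R -> R) : continuous w ->
    continuous ((fun r => (w r)%:C) : R -> R[i]^o).
  (* A positive element of R[i] is real, so a radius e is (Re e)%:C. *)
  move=> cw r; apply/cvgrPdist_lt => /= e e_gt0.
  move: (e_gt0); rewrite -[e]RRe_real ?gtr0_real // ltcR => Re_gt0.
  have /cvgrPdist_lt /(_ _ Re_gt0) := cw r.
  apply: filterS => s; rewrite -ltcR; congr (_ < _).
  by rewrite -rmorphB normc_def /= expr0n addr0 sqrtr_sqr.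
rewrite (_ : (fun _ => _) = (fun r => (u r)%:C + 'i%C * (v r)%:C)).
  move=> r; apply: (@cvgD _ R[i]^o); first exact: cC.
  exact: (@cvgZl_tmp _ R[i]^o _ _ _ 'i%C (fun r => (v r)%:C) (v r)%:C (cC v cv r)).
by apply/funext => r; rewrite [LHS]complexE.
Qed.

(** Continuity entry by entry rather than in a topology on column vectors: it
    is preserved by [recast], whose dimensions need not be convertible. *)
Definition coordwise_continuous p (g : R -> 'cV[R]_p) :=
  forall i, continuous (fun r => g r i 0).

Lemma recast_continuous p q (g : R -> 'cV[R]_p) :
  coordwise_continuous g -> coordwise_continuous (fun r => recast q (g r)).
Proof.
move=> cg i; have [pq|pq] := eqVneq p q.
  case: q / pq i => i.
  rewrite (_ : (fun _ => _) = (fun r => g r i 0)); first exact: cg.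
  by apply/funext => r; rewrite /recast conform_mx_id.
rewrite (_ : (fun _ => _) = cst 0); first exact: cst_continuous.
by apply/funext => r; rewrite /recast nonconform_mx ?pq // mxE.
Qed.

Lemma affine_continuous p q (W : 'M[R]_(q, p)) b (g : R -> 'cV[R]_p) :
  coordwise_continuous g -> coordwise_continuous (fun r => W *m g r + b).
Proof.
move=> cg i r.
rewrite (_ : (fun _ => _) = (fun r => \sum_j W i j * g r j 0 + b i 0)).
  apply: cvgD; last exact: cvg_cst.
  apply: cvg_big => [|j _]; first exact: add_continuous.
  by apply: cvgM; [exact: cvg_cst | exact: cg].
by apply/funext => s; rewrite !mxE.
Qed.

Variables (sigma : R -> R) (hsigma : continuous sigma).

Lemma F_continuous (m : nat -> nat) (t : params R m) (k : nat)
    (g : R -> 'cV[R]_(m 0%N)) :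
  coordwise_continuous g -> coordwise_continuous (fun r => F sigma t k (g r)).
Proof.
move=> cg; elim: k => [//|k IH] i r /=.
rewrite (_ : (fun _ => _) =
  sigma \o (fun r => (weight t k.+1 *m F sigma t k (g r) + bias t k.+1) i 0)).
  by apply: continuous_comp; [exact: affine_continuous | exact: hsigma].
by apply/funext => s; rewrite /= mxE.
Qed.

Variables (n : nat -> nat) (m : nat -> nat -> nat).
Variable th : forall l : nat, params R (m l).

Lemma gtilde_continuous l : coordwise_continuous (gtilde sigma n th l).
Proof.
elim: l => [|l IH] /=.
  move=> i; rewrite (_ : (fun _ => _) = id); first by move=> r; exact: cvg_id.
  by apply/funext => r; rewrite mxE.
by apply: F_continuous; exact: recast_continuous.
Qed.

Lemma ftilde_continuous l : coordwise_continuous (ftilde sigma n th l).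
Proof.
case: l => [|l]; last exact: (@affine_continuous _ _
  (weight (th l.+1) (n l.+1)) (bias (th l.+1) (n l.+1)) _ (@gtilde_continuous l.+1)).
move=> i; rewrite (_ : (fun _ => _) = cst 0); first exact: cst_continuous.
by apply/funext => r; rewrite mxE.
Qed.

Lemma CI_T q (g : R -> 'cV[R]_q) :
  coordwise_continuous g -> CI (fun r => T (g r)).
Proof.
move=> cg; apply: continuous_subspaceT.
by apply: complex_continuous; exact: recast_continuous.
Qed.

End NetworkContinuity.

(** * Residuals of the multi-grade model at the collocation points *)

Section MultiGradeAtNodes.
Variables (R : realType) (N : nat) (x : 'I_N -> R) (M : 'M[R[i]]_N).
Variable A : (R -> R[i]) -> R -> R[i].
Hypothesis hM : forall h, CI h -> nodal x (id_sub A h) = M *m nodal x h.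
Variables (sigma : R -> R) (hsigma : continuous sigma) (f : R -> R[i]).
Variables (n : nat -> nat) (m : nat -> nat -> nat).
Variable th : forall l : nat, params R (m l).

(** The residual of a grade subtracts from the previous one the operator
    applied to the new component only; through [M], which is linear, these
    contributions add up to that of the whole approximation. *)
Lemma nodal_estar l :
  nodal x (estar sigma A f n th l)
    = nodal x f - M *m nodal x (ytilde sigma n th l).
Proof.
elim: l => [|l IH] /=.
  rewrite (_ : nodal x (ytilde _ _ _ _) = 0) ?mulmx0 ?subr0 //.
  by apply/colP => j; rewrite !mxE /ytilde big_geq.
rewrite /residual nodalB IH.
rewrite hM; last exact: (CI_T (@ftilde_continuous _ _ hsigma n m th l.+1)).
rewrite -addrA -opprD -mulmxDr; congr (_ - M *m _).
by apply/colP => j; rewrite !mxE /ytilde [in RHS]big_nat_recr.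
Qed.

Lemma recast0 p q : recast q (0 : 'cV[R]_p) = 0.
Proof.
have [<-|pq] := eqVneq p q; first exact: conform_mx_id.
by rewrite /recast nonconform_mx ?pq.
Qed.

Definition zero_params l : params R (m l) :=
  @Params R (m l) (fun=> 0) (fun=> 0).

(** With zero output weights and bias, a grade adds the zero function to the
    approximation and keeps the residual: this is the competitor against which
    the minimizer of the grade is compared. *)
Lemma nodal_etilde0 l :
  nodal x (etilde sigma A f n th (zero_params l.+1))
    = nodal x (estar sigma A f n th l).
Proof.
rewrite /etilde /residual nodalB /=.
rewrite (_ : (fun r => T _) = (fun=> 0)); last first.
  by apply/funext => r; rewrite /net /= mul0mx addr0 /T recast0 !mxE.
rewrite hM ?nodal0 ?mulmx0 ?subr0 //.
exact/continuous_subspaceT/cst_continuous.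
Qed.

End MultiGradeAtNodes.

(** * The error estimate *)

Theorem theorem3 (R : realType)
  (kappa : R) (hkappa : 1 <= kappa)
  (K : R -> R -> R[i]) (hK : CI2 K)
  (f : R -> R[i]) (hf : CI f)
  (y : R -> R[i]) (hy : CI y)
  (hsol : forall s, I s -> id_sub (osc_op kappa K) y s = f s)
  (N : nat) (x : 'I_N -> R) (hx : forall j, I (x j)) (hxinj : injective x)
  (p : nat) (s : 'I_p.+1 -> R) (hs : forall j, I (s j))
  (Kp : (R -> R[i]) -> R -> R[i]) (hKp : quadrature_operator s Kp)
  (hp : p.+1 = N) (hnodes : range s = range x)
  (M : 'M[R[i]]_N) (hMinv : M \in unitmx)
  (hM : forall h, CI h ->
     (\col_(j < N) id_sub Kp h (x j)) = M *m (\col_(j < N) h (x j)))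
  (sigma : R -> R) (hsigma : continuous sigma)
  (L : nat) (hL : (0 < L)%N)
  (n : nat -> nat) (hn : forall l, (1 <= l <= L)%N -> (0 < n l)%N)
  (m : nat -> nat -> nat)
  (hm : forall l j, (1 <= l <= L)%N -> (j <= n l)%N -> (0 < m l j)%N)
  (hm_in : m 1%N 0%N = 1%N)
  (hm_out : forall l, (1 <= l <= L)%N -> m l (n l) = 2%N)
  (hm_next : forall l, (1 <= l < L)%N -> m l.+1 0%N = m l (n l).-1)
  (th : forall l, params R (m l))
  (hmin : forall l, (1 <= l <= L)%N -> forall t : params R (m l),
     normN x (etilde sigma Kp f n th (th l)) ^+ 2
       <= normN x (etilde sigma Kp f n th t) ^+ 2)
  (l : nat) (hl : (1 <= l <= L.-1)%N) :
  normN x (fun r => y r - ytilde sigma n th l.+1 r)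
    <= cond M * normN x (fun r => y r - ytilde sigma n th l r)
       + 2 * specnorm (invmx M)
           * normN x (fun r => Kp y r - osc_op kappa K y r).
Proof.
have Ll : (1 <= l.+1 <= L)%N.
  by case/andP: hl => _; rewrite /= -[L in (l < L)%N](prednK hL).
have hM' h : CI h -> nodal x (id_sub Kp h) = M *m nodal x h by exact: hM.
pose d k := nodal x (fun r => y r - ytilde sigma n th k r).
pose e k := nodal x (estar sigma Kp f n th k).
pose q := nodal x (fun r => Kp y r - osc_op kappa K y r).
pose c : R := Num.sqrt N%:R^-1.
(* At a node, f = y - K y = (y - Kp y) + (Kp y - K y). *)
have Md k : M *m d k = e k - q.
  rewrite /d /e nodalB mulmxBr -hM' // (nodal_estar hM') // addrAC; congr (_ - _).
  rewrite -nodalB; apply: eq_nodal => j; rewrite -hsol // /id_sub.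
  by rewrite opprB addrA subrK.
(* The zero network is a competitor for the minimum at grade l+1. *)
have e_le : c * l2norm (e l.+1) <= c * l2norm (e l).
  have := hmin _ Ll (@zero_params R m l.+1).
  by rewrite ler_sqr ?nnegrE ?normN_ge0 // !normN_nodal (nodal_etilde0 hM').
have d_le : l2norm (d l.+1) <=
    specnorm (invmx M) * (l2norm (e l.+1) + l2norm q).
  rewrite -[d l.+1](mulKmx hMinv) Md.
  apply: le_trans (ler_l2norm_mulmx _ _) _.
  by rewrite ler_wpM2l ?specnorm_ge0 // ler_l2normB.
have e_ub : l2norm (e l) <= specnorm M * l2norm (d l) + l2norm q.
  rewrite -[e l](subrK q) -Md.
  apply: le_trans (ler_l2normD _ _) _.
  by rewrite lerD2r ler_l2norm_mulmx.
have c_ge0 : 0 <= c by exact: sqrtr_ge0.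
have s_ge0 := specnorm_ge0 (invmx M).
rewrite !normN_nodal -/c -/(d _) -/(d _) -/q /cond.
apply: (le_trans (ler_wpM2l c_ge0 d_le)).
rewrite mulrCA mulrDr.
have := ler_wpM2l s_ge0 (le_trans e_le (ler_wpM2l c_ge0 e_ub)).
lra.
Qed.
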